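(* Consider six qubits $q_1,\dots,q_6$, where $q_1$ (data) is initially in an arbitrary pure state $|\psi\rangle=\alpha|0\rangle+\beta|1\rangle$ and the ancillas $q_2,\dots,q_6$ are initially in $|00000\rangle$. Let $U_{\mathrm{enc}}$ and $U_{\mathrm{dec}}$ be the encoding and decoding circuits defined in the context, and suppose a single-qubit Pauli error $E_j$ (the Pauli $E$ acting on qubit $q_j$) occurs between encoding and decoding. Then: (a) (Correction of dominant errors) For every $E\in\{X,Y\}$ and every $j\in\{1,\dots,6\}$ there is a bit string $s(E,j)\in\{0,1\}^5$, not depending on $|\psi\rangle$ and different from the syndrome obtained when no error occurs, such that $$U_{\mathrm{dec}}\,E_j\,U_{\mathrm{enc}}\,(|\psi\rangle\otimes|00000\rangle)=|\psi\rangle\otimes|s(E,j)\rangle$$ up to a global phase. Thus any single $X$ or $Y$ error on any of the six qubits is detected and corrected. (b) (Flagging of $Z$ errors) For a single $Z$ error $Z_j$, the syndrome is the flag string $00100$, and this string is different from $s(E,i)$ for all $E\in\{X,Y\}$ and $i\in\{1,\dots,6\}$.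
   Context: $\mathrm{CNOT}(a\to b)$ denotes the controlled-NOT gate with control $a$ and target $b$; $\mathrm{CCX}(a,b\to c)$ denotes the Toffoli gate with controls $a,b$ and target $c$; $\mathrm{CCCX}(a,b,c\to d)$ denotes the triply-controlled NOT gate with controls $a,b,c$ and target $d$; $H(a)$ is the Hadamard gate on $a$. Gates are listed in order of application. $U_{\mathrm{enc}}$: $\mathrm{CNOT}(q_1\to q_4)$; $H(q_1)$, $H(q_4)$; $\mathrm{CNOT}(q_1\to q_2)$, $\mathrm{CNOT}(q_4\to q_5)$; $\mathrm{CNOT}(q_1\to q_3)$, $\mathrm{CNOT}(q_4\to q_6)$. $U_{\mathrm{dec}}$: $\mathrm{CNOT}(q_1\to q_2)$, $\mathrm{CNOT}(q_4\to q_5)$; $\mathrm{CNOT}(q_1\to q_3)$, $\mathrm{CNOT}(q_4\to q_6)$; $\mathrm{CCX}(q_2,q_3\to q_1)$, $\mathrm{CCX}(q_5,q_6\to q_4)$; $H(q_1)$, $H(q_4)$; $\mathrm{CNOT}(q_1\to q_4)$; $\mathrm{CNOT}(q_4\to q_1)$; $\mathrm{CCCX}(q_4,q_5,q_6\to q_1)$; $\mathrm{CCX}(q_4,q_6\to q_1)$; $\mathrm{CCX}(q_4,q_5\to q_1)$. Tensor factors are ordered $q_1,\dots,q_6$. The syndrome is the final computational-basis state of the ancillas $(q_2,q_3,q_4,q_5,q_6)$, written as a 5-bit string in that order. *)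

(* Defs.v *)
From HB Require Import structures.
From mathcomp Require Import all_boot all_order all_algebra.
From mathcomp Require Import complex reals.

Set Implicit Arguments.
Unset Strict Implicit.
Unset Printing Implicit Defensive.

Import Order.TTheory GRing.Theory Num.Theory.
Local Open Scope ring_scope.

Definition bits (n : nat) := n.-tuple 'I_2.

(* A vector of the n-qubit space, given by its amplitudes in the computational
   basis; position i of a bit string is the i-th tensor factor. *)
Definition qvec (C : numClosedFieldType) (n : nat) := {ffun bits n -> C}.

Definition ket {C : numClosedFieldType} {n : nat} (s : bits n) : qvec C n :=
  [ffun x => (x == s)%:R].

Definition tensor {C : numClosedFieldType} {m n : nat}
    (u : qvec C m) (v : qvec C n) : qvec C (m + n) :=
  [ffun x : bits (m + n) => u [tuple tnth x (lshift n i) | i < m]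
                          * v [tuple tnth x (rshift m i) | i < n]].

Definition pure_state {C : numClosedFieldType} {n : nat} (v : qvec C n) : Prop :=
  \sum_x `|v x| ^+ 2 = 1.

Definition eq_up_to_phase {C : numClosedFieldType} {n : nat}
    (u v : qvec C n) : Prop :=
  exists2 c : C, `|c| = 1 & forall x, u x = c * v x.

Definition set_bit {n : nat} (x : bits n) (t : 'I_n) (b : 'I_2) : bits n :=
  [tuple if i == t then b else tnth x i | i < n].

(* The 2 x 2 matrix U applied to qubit t, conditioned on every qubit in the
   list cs being 1. This is the usual controlled gate only when t is not in cs. *)
Definition cgate {C : numClosedFieldType} {n : nat} (cs : seq 'I_n) (t : 'I_n)
    (U : 'M[C]_2) (v : qvec C n) : qvec C n :=
  [ffun x => if all (fun c => tnth x c == 1) cs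
             then \sum_(b < 2) U (tnth x t) b * v (set_bit x t b)
             else v x].

Definition mx2 {C : numClosedFieldType} (a b c d : C) : 'M[C]_2 :=
  \matrix_(i, j) if i == 0 then (if j == 0 then a else b)
                           else (if j == 0 then c else d).

Inductive pauli := PauliX | PauliY | PauliZ.

Definition pauli_mx (C : numClosedFieldType) (E : pauli) : 'M[C]_2 :=
  match E with
  | PauliX => mx2 0 1 1 0
  | PauliY => mx2 0 (- 'i) 'i 0
  | PauliZ => mx2 1 0 0 (- 1)
  end.

Definition hadamard_mx (C : numClosedFieldType) : 'M[C]_2 :=
  (sqrtC 2)^-1 *: mx2 1 1 1 (- 1).

Definition pauli_on {C : numClosedFieldType} {n : nat} (E : pauli) (j : 'I_n) :
  qvec C n -> qvec C n := cgate [::] j (pauli_mx C E).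

Definition H {C : numClosedFieldType} {n : nat} (a : 'I_n) :
  qvec C n -> qvec C n := cgate [::] a (hadamard_mx C).

Definition CNOT {C : numClosedFieldType} {n : nat} (a b : 'I_n) :
  qvec C n -> qvec C n := cgate [:: a] b (pauli_mx C PauliX).

Definition CCX {C : numClosedFieldType} {n : nat} (a b c : 'I_n) :
  qvec C n -> qvec C n := cgate [:: a; b] c (pauli_mx C PauliX).

Definition CCCX {C : numClosedFieldType} {n : nat} (a b c d : 'I_n) :
  qvec C n -> qvec C n := cgate [:: a; b; c] d (pauli_mx C PauliX).

(* The head of the list is applied first. *)
Definition run {C : numClosedFieldType} {n : nat}
    (gates : seq (qvec C n -> qvec C n)) (v : qvec C n) : qvec C n :=
  foldl (fun w g => g w) v gates.

Definition q1 : 'I_6 := @Ordinal 6 0 isT.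
Definition q2 : 'I_6 := @Ordinal 6 1 isT.
Definition q3 : 'I_6 := @Ordinal 6 2 isT.
Definition q4 : 'I_6 := @Ordinal 6 3 isT.
Definition q5 : 'I_6 := @Ordinal 6 4 isT.
Definition q6 : 'I_6 := @Ordinal 6 5 isT.

Definition Uenc {C : numClosedFieldType} : qvec C 6 -> qvec C 6 :=
  run [:: CNOT q1 q4;
          H q1; H q4;
          CNOT q1 q2; CNOT q4 q5;
          CNOT q1 q3; CNOT q4 q6].

Definition Udec {C : numClosedFieldType} : qvec C 6 -> qvec C 6 :=
  run [:: CNOT q1 q2; CNOT q4 q5;
          CNOT q1 q3; CNOT q4 q6;
          CCX q2 q3 q1; CCX q5 q6 q4;
          H q1; H q4;
          CNOT q1 q4;
          CNOT q4 q1;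
          CCCX q4 q5 q6 q1;
          CCX q4 q6 q1;
          CCX q4 q5 q1].

Definition zeros5 : bits 5 := [tuple 0; 0; 0; 0; 0].
Definition flagZ : bits 5 := [tuple 0; 0; 1; 0; 0].

Definition init {C : numClosedFieldType} (psi : qvec C 1) : qvec C 6 :=
  tensor psi (ket zeros5).

(* The ancillas q2, ..., q6 are in the basis state s; the data qubit may be in
   any pure state. *)
Definition has_syndrome {C : numClosedFieldType} (v : qvec C 6) (s : bits 5) :
    Prop :=
  exists2 phi : qvec C 1, pure_state phi & v = tensor phi (ket s).

(* Main.v *)
Require Import Defs.
From HB Require Import structures.
From mathcomp Require Import all_boot all_order all_algebra.
From mathcomp Require Import complex reals.

Set Implicit Arguments.
Unset Strict Implicit.
Unset Printing Implicit Defensive.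

Import Order.TTheory GRing.Theory Num.Theory.
Local Open Scope ring_scope.

(** Up to a scalar ([1/sqrt 2] for each Hadamard gate and ['i] for [Y]), every
    gate has entries in [{0, 1, -1}], so every amplitude of the final state is a
    common scalar times an integral combination of the two amplitudes of [psi].
    These pairs of integers are computed by evaluating the circuits on symbolic
    states, and compared with the expected output on the 64 basis states. *)

(** * Symbolic circuits with integral amplitudes *)

Definition symstate := bitseq -> int * int.

Definition assign (k : bitseq) (t : nat) (b : bool) := set_nth false k t b.

Definition flip (k : bitseq) (t : nat) := assign k t (~~ nth false k t).

Definition symCX (cs : seq nat) (t : nat) (f : symstate) : symstate :=
  fun k => if all (nth false k) cs then f (flip k t) else f k.

Definition symH (t : nat) (f : symstate) : symstate :=
  fun k => if nth false k t then f (assign k t false) - f (assign k t true)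
           else f (assign k t false) + f (assign k t true).

(* [Y] is ['i] times the integral gate below. *)
Definition sym_pauli (E : pauli) (t : nat) (f : symstate) : symstate :=
  match E with
  | PauliX => symCX [::] t f
  | PauliY => fun k => if nth false k t then f (flip k t) else - f (flip k t)
  | PauliZ => fun k => if nth false k t then - f k else f k
  end.

Definition symrun (gs : seq (symstate -> symstate)) (f : symstate) :=
  foldl (fun g s => s g) f gs.

(** Positions count from 0, so [q1] is position 0 and [q4] is position 3. *)
Definition sym_enc : symstate -> symstate :=
  symrun [:: symCX [:: 0] 3;
             symH 0; symH 3;
             symCX [:: 0] 1; symCX [:: 3] 4;
             symCX [:: 0] 2; symCX [:: 3] 5]%N.

Definition sym_dec : symstate -> symstate :=
  symrun [:: symCX [:: 0] 1; symCX [:: 3] 4;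
             symCX [:: 0] 2; symCX [:: 3] 5;
             symCX [:: 1; 2] 0; symCX [:: 4; 5] 3;
             symH 0; symH 3;
             symCX [:: 0] 3;
             symCX [:: 3] 0;
             symCX [:: 3; 4; 5] 0;
             symCX [:: 3; 5] 0;
             symCX [:: 3; 4] 0]%N.

(* [X^fl psi] on the data qubit, tensored with the basis state [s]. *)
Definition sym_tensor (fl : bool) (s : bitseq) : symstate :=
  fun k => if behead k == s
           then if head false k (+) fl then (0, 1) else (1, 0) else 0.

(** * Basis states as Boolean sequences *)

Definition key n (x : bits n) : bitseq := [seq b == 1 | b <- x].

Lemma ord2P (b : 'I_2) : b = if b == 1 then 1 else 0.
Proof. by apply: val_inj; case: b => [[|[|]]]. Qed.

Lemma size_key n (x : bits n) : size (key x) = n.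
Proof. by rewrite size_map size_tuple. Qed.

Lemma key_inj n : injective (@key n).
Proof.
move=> x y /inj_map exy; apply/val_inj/exy => a b eab.
by rewrite (ord2P a) eab -ord2P.
Qed.

Lemma nth_key n (x : bits n) (t : 'I_n) : nth false (key x) t = (tnth x t == 1).
Proof. by rewrite (nth_map 0) ?size_tuple // -tnth_nth. Qed.

Lemma key_set_bit n (x : bits n) (t : 'I_n) b :
  key (set_bit x t b) = assign (key x) t (b == 1).
Proof.
apply: (@eq_from_nth _ false).
  (* [set_nth] would pad past the end; the length stays [n] because [t < n]. *)
  by rewrite size_set_nth !size_key; apply/esym/maxn_idPr.
move=> m; rewrite size_key => lt_mn; pose i := Ordinal lt_mn.
rewrite -[m]/(val i) nth_key tnth_mktuple nth_set_nth /= -[m]/(val i) nth_key.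
by rewrite -[\val i == t]/(i == t); case: (i == t).
Qed.

Fixpoint bitseqs n : seq bitseq :=
  if n is n'.+1 then
    map (cons false) (bitseqs n') ++ map (cons true) (bitseqs n')
  else [:: [::]].

Lemma mem_bitseqs n (k : bitseq) : size k = n -> k \in bitseqs n.
Proof.
elim: n k => [|n IHn] [|b k] //= [/IHn k_in]; rewrite mem_cat.
by case: b; apply/orP; [right | left]; apply: map_f.
Qed.

(** * Soundness of the symbolic evaluation *)

Section Represents.

Variables (C : numClosedFieldType) (psi : qvec C 1).

Definition interp (p : int * int) : C :=
  p.1%:~R * psi [tuple 0] + p.2%:~R * psi [tuple 1].

Lemma interpD p q : interp (p + q) = interp p + interp q.
Proof. by rewrite /interp !rmorphD /= !mulrDl addrACA. Qed.

Lemma interpN p : interp (- p) = - interp p.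
Proof. by rewrite /interp !rmorphN /= !mulNr opprD. Qed.

Lemma interpMn p n : interp (p *+ n) = interp p *+ n.
Proof.
elim: n => [|n IHn]; last by rewrite !mulrS interpD IHn.
by rewrite !mulr0n /interp !mul0r addr0.
Qed.

(** The scalar [c] absorbs every non-integral factor, so that [f] stays computable. *)
Definition represents n (c : C) (f : symstate) (v : qvec C n) :=
  forall x, v x = c * interp (f (key x)).

Lemma cgateE n (cs : seq 'I_n) t (U : 'M[C]_2) (v : qvec C n) x :
  cgate cs t U v x =
  if all (nth false (key x)) (map val cs) then
    U (tnth x t) 0 * v (set_bit x t 0) + U (tnth x t) 1 * v (set_bit x t 1)
  else v x.
Proof.
rewrite ffunE all_map (eq_all (a2 := preim val (nth false (key x)))); last first.
  by move=> i /=; rewrite nth_key.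
case: ifP => // _; rewrite !big_ord_recl big_ord0 addr0.
by have -> : lift ord0 ord0 = 1 :> 'I_2 by apply: val_inj.
Qed.

(** An arbitrary control list covers [CNOT], [CCX], [CCCX] and, when empty, the [X] error. *)
Lemma represents_CX n c f (v : qvec C n) (cs : seq 'I_n) (t : 'I_n) :
  represents c f v ->
  represents c (symCX (map val cs) t f) (cgate cs t (pauli_mx C PauliX) v).
Proof.
move=> fv x; rewrite cgateE /symCX; case: ifP => // _.
rewrite !fv !key_set_bit /flip nth_key !mxE (ord2P (tnth x t)).
by case: (tnth x t == 1); rewrite /= ?mul0r ?mul1r ?addr0 ?add0r.
Qed.

Lemma represents_H n c f (v : qvec C n) (t : 'I_n) :
  represents c f v -> represents (c / sqrtC 2) (symH t f) (H t v).
Proof.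
move=> fv x; rewrite cgateE /symH /= nth_key !fv !key_set_bit !mxE.
rewrite (ord2P (tnth x t)).
case: (tnth x t == 1); rewrite /= ?interpD ?interpN !(mulr1, mulrN, mulNr);
  by rewrite [c / _]mulrC -mulrA !(mulrDr, mulrN).
Qed.

Definition pauli_phase (E : pauli) : C := if E is PauliY then 'i else 1.

Lemma represents_pauli n c f (v : qvec C n) E (t : 'I_n) :
  represents c f v ->
  represents (c * pauli_phase E) (sym_pauli E t f) (pauli_on E t v).
Proof.
move=> fv; case: E; first by rewrite mulr1; exact: represents_CX.
- move=> x; rewrite cgateE /= /flip nth_key !fv !key_set_bit !mxE.
  rewrite (ord2P (tnth x t)).
  case: (tnth x t == 1); rewrite /= ?interpN !(mul0r, addr0, add0r);
  by rewrite mulrCA mulrA ?mulrN ?mulNr.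
- move=> x; rewrite cgateE /= nth_key !mxE mulr1.
  (* [Z] is diagonal: the only surviving term rewrites a bit of [x] by itself. *)
  have set_id : set_bit x t (tnth x t) = x.
    by apply: eq_from_tnth => i; rewrite tnth_mktuple; case: eqP => [->|].
  move: set_id; rewrite (ord2P (tnth x t)).
  case: (tnth x t == 1) => /= ->;
  by rewrite !(mul0r, mul1r, addr0, add0r) !fv ?interpN ?mulNr ?mulrN ?mul1r.
Qed.

(** Subtraction in ['I_2] is modulo 2, so [1 - b] is the opposite bit and this is [X] raised to the
    power [fl]. *)
Definition qX (fl : bool) (phi : qvec C 1) : qvec C 1 :=
  if fl then [ffun x => phi [tuple 1 - tnth x ord0]] else phi.

Lemma represents_tensor fl (s : bits 5) :
  represents 1 (sym_tensor fl (key s)) (tensor (qX fl psi) (ket s)).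
Proof.
move=> x; rewrite /tensor !ffunE mul1r.
set y := [tuple tnth x (rshift 1 i) | i < 5].
set z := [tuple tnth x (lshift 5 i) | i < 1].
have zE : z = [tuple tnth x ord0].
  apply: eq_from_tnth => i; rewrite tnth_mktuple [RHS](tnth_nth 0) ord1 /=.
  by congr tnth; apply: val_inj.
(* The data bit heads the key and the ancillas form its tail, as [sym_tensor] expects. *)
have kx : key x = (tnth x ord0 == 1) :: key y.
  apply: (@eq_from_nth _ false) => [|m]; first by rewrite /= !size_key.
  rewrite size_key; case: m => [|m] lt_m; first by rewrite -nth_key.
  rewrite [RHS]/= -[m]/(val (Ordinal (lt_m : (m < 5)%N))) nth_key tnth_mktuple.
  by rewrite -nth_key.
rewrite /sym_tensor kx /= (inj_eq (@key_inj 5)).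
case: (y == s); last by rewrite mulr0 /interp !mul0r addr0.
rewrite mulr1 zE /interp /qX.
case: fl; rewrite ?ffunE (ord2P (tnth x ord0)) ?(tnth_nth 0) /=.
  have e11 : 1 - 1 = 0 :> 'I_2 by apply: val_inj.
  have e10 : 1 - 0 = 1 :> 'I_2 by apply: val_inj.
  by case: (_ == 1); rewrite /= ?e11 ?e10 ?mul0r ?mul1r ?addr0 ?add0r.
by case: (_ == 1); rewrite /= ?mul0r ?mul1r ?addr0 ?add0r.
Qed.

(** Flipping the index permutes the terms of the norm. [has_syndrome] needs this purity after [Z]
    errors on [q4], [q5], [q6]. *)
Lemma pure_state_qX fl : pure_state psi -> pure_state (qX fl psi).
Proof.
rewrite /pure_state; case: fl => // <-.
rewrite (reindex_inj (h := fun x : bits 1 => [tuple 1 - tnth x ord0])) /=.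
  apply: eq_bigr => x _; rewrite ffunE; congr (`|psi _| ^+ 2).
  apply: eq_from_tnth => i; rewrite (ord1 i) !(tnth_nth 0) /=.
  by rewrite opprB addrC subrK.
move=> x y /(congr1 (fun z => tnth z ord0)); rewrite !(tnth_nth 0) /=.
move/addrI/oppr_inj => exy; apply: eq_from_tnth => i.
by rewrite (ord1 i) !(tnth_nth 0).
Qed.

Lemma represents_Uenc c f (v : qvec C 6) :
  represents c f v ->
  represents (c / sqrtC 2 / sqrtC 2) (sym_enc f) (Uenc v).
Proof.
move=> fv; rewrite /Uenc /sym_enc /run /symrun /=.
(* Gates are peeled off from the last applied to the first; the list pattern fixes the number of
   controls. *)
do 4 apply: (represents_CX [:: _]).
by do 2 apply: represents_H; apply: (represents_CX [:: _]).
Qed.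

Lemma represents_Udec c f (v : qvec C 6) :
  represents c f v ->
  represents (c / sqrtC 2 / sqrtC 2) (sym_dec f) (Udec v).
Proof.
move=> fv; rewrite /Udec /sym_dec /run /symrun /=.
do 2 apply: (represents_CX [:: _; _]).
apply: (represents_CX [:: _; _; _]).
do 2 apply: (represents_CX [:: _]).
do 2 apply: represents_H; do 2 apply: (represents_CX [:: _; _]).
by do 4 apply: (represents_CX [:: _]).
Qed.

(** The factor 4 is the fourth power of [sqrtC 2], from the four unnormalised [symH] gates. *)
Definition agree (f : symstate) fl s :=
  all (fun k => f k == sym_tensor fl s k *+ 4) (bitseqs 6).

(** Every key of length 6 lies in [bitseqs 6], so the finite check settles all amplitudes. *)
Lemma represents_agree c f fl (s : bits 5) (v : qvec C 6) :
  represents (c / sqrtC 2 / sqrtC 2 / sqrtC 2 / sqrtC 2) f v ->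
  agree f fl (key s) ->
  forall x, v x = c * tensor (qX fl psi) (ket s) x.
Proof.
move=> fv /allP agr x.
rewrite fv (eqP (agr _ (mem_bitseqs (size_key x)))) interpMn.
rewrite represents_tensor mul1r -[_ *+ 4]mulr_natl.
suff -> : c / sqrtC 2 / sqrtC 2 / sqrtC 2 / sqrtC 2 = c / 4%:R.
  by rewrite mulrA divfK // pnatr_eq0.
by rewrite -!mulrA -!invfM mulrA -!expr2 sqrtCK -natrX.
Qed.

End Represents.

(** * Syndrome table and evaluation of the circuits *)

(** A bit flip on [q1] or [q4] sets both other bits of its block of three; on another qubit it sets
    that qubit's own bit. The bit [z] of [q4] records the phase part of [Y], which is [X] times [Z]
    up to a phase. *)
Definition syndrome (E : pauli) (j : 'I_6) : bits 5 :=
  let z : 'I_2 := if E is PauliX then 0 else 1 in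
  match val j with
  | 0%N => [tuple 1; 1; z; 0; 0]
  | 1%N => [tuple 1; 0; z; 0; 0]
  | 2%N => [tuple 0; 1; z; 0; 0]
  | 3%N => [tuple 0; 0; z; 1; 1]
  | 4%N => [tuple 0; 0; z; 1; 0]
  | _ => [tuple 0; 0; z; 0; 1]
  end.

Definition sym_init : symstate := sym_tensor false (nseq 5 false).

Definition sym_output (E : pauli) (j : nat) : symstate :=
  sym_dec (sym_pauli E j (sym_enc sym_init)).

Lemma agree_no_error : agree (sym_dec (sym_enc sym_init)) false (key zeros5).
Proof. by vm_compute. Qed.

Lemma agree_XY E (j : 'I_6) : E = PauliX \/ E = PauliY ->
  agree (sym_output E j) false (key (syndrome E j)).
Proof.
by case: j => [[|[|[|[|[|[|//]]]]]] lt_j] [] -> ; vm_compute.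
Qed.

(* A [Z] error in the second block also flips the data qubit. *)
Lemma agree_Z (j : 'I_6) : agree (sym_output PauliZ j) (2 < j)%N (key flagZ).
Proof. by case: j => [[|[|[|[|[|[|//]]]]]] lt_j]; vm_compute. Qed.

Lemma syndrome_neq E (j : 'I_6) : E = PauliX \/ E = PauliY ->
  syndrome E j <> zeros5 /\ flagZ <> syndrome E j.
Proof.
by case: j => [[|[|[|[|[|[|//]]]]]] lt_j] [] ->;
  split=> /(congr1 (@key 5)); vm_compute.
Qed.

Lemma represents_output (C : numClosedFieldType) (psi : qvec C 1) E (j : 'I_6) :
  represents psi
    (pauli_phase C E / sqrtC 2 / sqrtC 2 / sqrtC 2 / sqrtC 2)
    (sym_output E j) (Udec (pauli_on E j (Uenc (init psi)))).
Proof.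
(* The error acts between the two Hadamards of the encoder and the two of the decoder; its phase is
   moved to the front to serve as [c] in [represents_agree]. *)
suff -> : pauli_phase C E / sqrtC 2 / sqrtC 2 =
    1 / sqrtC 2 / sqrtC 2 * pauli_phase C E.
  apply/represents_Udec/represents_pauli/represents_Uenc.
  exact: (represents_tensor psi false zeros5).
by rewrite mul1r -mulrA mulrC.
Qed.

Theorem mainTheorem4 (R : realType) :
  exists (s0 : bits 5) (s : pauli -> 'I_6 -> bits 5),
    [/\ forall psi : qvec R[i] 1, pure_state psi ->
          has_syndrome (Udec (Uenc (init psi))) s0,
        forall (E : pauli) (j : 'I_6), E = PauliX \/ E = PauliY ->
          s E j <> s0 /\
          forall psi : qvec R[i] 1, pure_state psi ->
            eq_up_to_phase (Udec (pauli_on E j (Uenc (init psi))))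
                           (tensor psi (ket (s E j))),
        forall (j : 'I_6) (psi : qvec R[i] 1), pure_state psi ->
          has_syndrome (Udec (pauli_on PauliZ j (Uenc (init psi)))) flagZ
      & forall (E : pauli) (i : 'I_6), E = PauliX \/ E = PauliY ->
          flagZ <> s E i].
Proof.
exists zeros5, syndrome; split.
- move=> psi pure; exists psi => //; apply/ffunP => x.
  rewrite -[RHS]mul1r; apply: (represents_agree (fl := false)) agree_no_error x.
  apply/represents_Udec/represents_Uenc.
  exact: (represents_tensor psi false zeros5).
- move=> E j EXY; split; first by have [] := syndrome_neq j EXY.
  move=> psi _; exists (pauli_phase _ E).
    by case: (E); rewrite /= ?normr1 ?normCi.
  apply: (represents_agree (fl := false)) (agree_XY j EXY).
  exact: represents_output.
- move=> j psi pure; exists (qX (2 < j)%N psi); first exact: pure_state_qX.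
  (* [has_syndrome] asks for an exact equality; [pauli_phase] is 1 for [Z]. *)
  apply/ffunP => x; rewrite -[RHS]mul1r.
  exact: represents_agree (represents_output psi PauliZ j) (agree_Z j) x.
- by move=> E j EXY; have [] := syndrome_neq j EXY.
Qed.
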